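(* Let $t\ge 1$. If $(4t)K_2$ admits a $1$-super graceful labeling in which all edge labels are even, then $(4t+1)K_2$ also admits a $1$-super graceful labeling in which all edge labels are even.
   Context: $nK_2$ denotes the disjoint union of $n$ copies of $K_2$. For integers $a\le b$, $[a,b]$ is the set of integers between $a$ and $b$ inclusive. For $k\ge 1$, a $k$-super graceful labeling of a graph $G=(V,E)$ with $p$ vertices and $q$ edges is a bijection $f:V\cup E\to[k,k+p+q-1]$ with $f(uv)=|f(u)-f(v)|$ for every edge $uv$. *)

(* Defs.v *)
From mathcomp Require Import all_boot all_order all_algebra.
Set Implicit Arguments.
Unset Strict Implicit.
Unset Printing Implicit Defensive.

Record sgraph := SGraph {
  vertex :> finType;
  adj : rel vertex;
  adj_sym : symmetric adj;
  adj_irrefl : irreflexive adj }.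

Definition edges (G : sgraph) : {set {set G}} :=
  [set [set u; v] | u in G, v in G & adj u v].

Definition edge (G : sgraph) := {e : {set G} | e \in edges G}.

Section Complete.
Variable n : nat.
Definition complete_adj : rel 'I_n := fun u v => u != v.
Lemma complete_adj_sym : symmetric complete_adj.
Proof. by move=> u v; rewrite /complete_adj eq_sym. Qed.
Lemma complete_adj_irrefl : irreflexive complete_adj.
Proof. by move=> u; rewrite /complete_adj eqxx. Qed.
Definition complete : sgraph := SGraph complete_adj_sym complete_adj_irrefl.
End Complete.

Section Copies.
Variables (n : nat) (G : sgraph).
Definition copies_adj : rel ('I_n * G) :=
  fun x y => (x.1 == y.1) && adj x.2 y.2.
Lemma copies_adj_sym : symmetric copies_adj.
Proof. by move=> x y; rewrite /copies_adj eq_sym adj_sym. Qed.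
Lemma copies_adj_irrefl : irreflexive copies_adj.
Proof. by move=> x; rewrite /copies_adj adj_irrefl andbF. Qed.
(* The disjoint union of n copies of G; the first coordinate names the copy. *)
Definition copies : sgraph := SGraph copies_adj_sym copies_adj_irrefl.
End Copies.

(* V ∪ E is the sum type [G + edge G].  The last two clauses say that f is a
   bijection onto [k, k + p + q - 1]; the truncated [- 1] is exact for k >= 1. *)
Definition super_graceful (k : nat) (G : sgraph) (f : G + edge G -> nat) : Prop :=
  [/\ forall (u v : G) (e : edge G), val e = [set u; v] ->
        f (inr e) = `|f (inl u) - f (inl v)|%N,
      injective f
    & forall m : nat,
        (exists x, f x = m) <-> k <= m <= k + #|G| + #|edges G| - 1].

Definition even_edge_labels (G : sgraph) (f : G + edge G -> nat) : Prop :=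
  forall e : edge G, ~~ odd (f (inr e)).

(* Main.v *)
Require Import Defs.
From mathcomp Require Import all_boot all_order all_algebra.
From mathcomp Require Import zify.

(** Let [n] be even and let [nK_2] carry a 1-super graceful labeling with even
    edge labels, so that the labels are [1, ..., 3n].  The two ends of an edge
    have labels of the same parity, hence adding 2 to every odd label changes
    no edge label.  The odd labels become [3, 5, ..., 3n + 1], which leaves
    exactly [1], [3n + 2] and [3n + 3] unused, and these label one more copy
    of [K_2] since [(3n + 3) - 1 = 3n + 2]. *)

Notation matching n := (copies n (complete 2)).

Section Matching.
Variable n : nat.

Lemma matching_edge_subproof (i : 'I_n) :
  [set (i, ord0); (i, ord_max)] \in edges (matching n).
Proof.
apply/imset2P; exists (i, ord0) (i, ord_max) => //.
by rewrite inE /= /copies_adj /= eqxx.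
Qed.

Definition matching_edge (i : 'I_n) : edge (matching n) :=
  exist (fun e => e \in edges (matching n)) _ (matching_edge_subproof i).

Lemma matching_edge_inj : injective matching_edge.
Proof.
move=> i j /(congr1 val) /= /setP /(_ (i, ord0)).
by rewrite !inE eqxx /= => /esym /orP [] /eqP [].
Qed.

(** The labeling condition ranges over every way to write an edge as [[set u; v]], so both orders of
    the ends must be allowed for. *)
Lemma matching_edge_ends (i : 'I_n) (u v : matching n) :
  val (matching_edge i) = [set u; v] ->
  (u = (i, ord0) /\ v = (i, ord_max)) \/ (u = (i, ord_max) /\ v = (i, ord0)).
Proof.
move=> /= /setP E.
move: (E u) (E v) (E (i, ord0)) (E (i, ord_max)).
rewrite !inE !eqxx !orbT /= => /orP [] /eqP -> /orP [] /eqP -> //; auto.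
(* The two remaining goals have [u = v]; such a singleton misses one end of the edge. *)
- by move=> _; rewrite xpair_eqE eqxx.
- by rewrite xpair_eqE eqxx.
Qed.

Lemma matching_edge_surj (e : edge (matching n)) :
  exists i, e = matching_edge i.
Proof.
case: e => e he; case/imset2P: (he) => -[i a] [j b] _.
rewrite inE /= => /andP [/= /eqP ij ab] ee; subst j.
exists i; apply: val_inj => /=; rewrite ee.
(* As [a] and [b] are distinct in ['I_2], only the two mixed cases are consistent; they differ by
   the order of the pair. *)
have [a0|a0] := eqVneq a ord0; have [b0|b0] := eqVneq b ord0.
- by move: ab; rewrite /complete_adj a0 b0.
- rewrite a0; congr [set _; (_, _)]; apply: val_inj.
  by case: b b0 {ab he ee} => [[|[|]]].
- rewrite b0 setUC; congr [set _; (_, _)]; apply: val_inj.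
  by case: a a0 {ab he ee} => [[|[|]]].
- by move: a b a0 b0 ab {he ee} => [[|[|]] //= ?] [[|[|]] //= ?].
Qed.

Lemma card_matching : #|matching n| = n * 2.
Proof. by rewrite card_prod !card_ord. Qed.

Lemma card_matching_edges : #|edges (matching n)| = n.
Proof.
have -> : edges (matching n) = [set val (matching_edge i) | i : 'I_n].
  apply/setP=> e; apply/idP/imsetP => [he|[i _ ->]]; last exact: valP.
  have [i ei] := matching_edge_surj (exist _ e he).
  by exists i => //; rewrite -ei.
rewrite card_imset ?card_ord // => i j /val_inj; exact: matching_edge_inj.
Qed.

(** Coordinates for the labeled objects: in each copy, [None] stands for the edge and [Some c] for
    an end. *)
Definition matching_item (x : 'I_n * option 'I_2) :
    matching n + edge (matching n) :=
  if x.2 is Some c then inl (x.1, c) else inr (matching_edge x.1).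

(** Injectivity suffices, since both sides have [3 * n] elements. *)
Lemma matching_item_bij : bijective matching_item.
Proof.
have inj : injective matching_item.
  move=> [i [c|]] [j [d|]] //; first by case=> -> ->.
  have inr_inj : injective (@inr (matching n) (edge (matching n))).
    by move=> ? ? [].
  by move=> /inr_inj /matching_edge_inj /= ->.
apply: (inj_card_bij inj).
rewrite card_sum !card_prod card_option !card_ord card_sig.
by rewrite -[#|[pred _ | _]|]/#|edges (matching n)| card_matching_edges; lia.
Qed.

Definition even_triples (F : 'I_n * option 'I_2 -> nat) : Prop :=
  [/\ forall i, F (i, None) = `|F (i, Some ord0) - F (i, Some ord_max)|%N,
      forall i, ~~ odd (F (i, None)),
      injective F
    & forall m, (exists x, F x = m) <-> 1 <= m <= 3 * n].

(** Labelings are transported along [matching_item], which removes edges as sets from the rest of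
    the argument. *)
Lemma super_graceful_even_triplesP :
  (exists f : matching n + edge (matching n) -> nat,
     super_graceful 1 f /\ even_edge_labels f) <->
  (exists F, even_triples F).
Proof.
have size m : (1 <= m <= 1 + #|matching n| + #|edges (matching n)| - 1)
    = (1 <= m <= 3 * n).
  by rewrite card_matching card_matching_edges; congr (_ && (_ <= _)); lia.
have [g gK Kg] := matching_item_bij.
split=> [[f [[fE f_inj f_img] f_even]]|[F [FE F_even F_inj F_img]]].
- exists (f \o matching_item); split.
  + by move=> i; apply: fE.
  + by move=> i; apply: f_even.
  + exact: inj_comp f_inj (can_inj gK).
  + move=> m; rewrite -size -f_img; split=> [[x]|[x <-]].
      by exists (matching_item x).
    by exists (g x); rewrite /= Kg.
- have gV (i : 'I_n) c : g (inl (i, c)) = (i, Some c).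
    by rewrite -[inl _]/(matching_item (i, Some c)) gK.
  have gE (i : 'I_n) : g (inr (matching_edge i)) = (i, None).
    by rewrite -[inr _]/(matching_item (i, None)) gK.
  exists (F \o g); split; last first.
    by move=> e; have [i ->] := matching_edge_surj e; rewrite /= gE.
  split.
  + move=> u v e; have [i ->] := matching_edge_surj e.
    case/matching_edge_ends=> -[-> ->]; rewrite /= gE !gV FE //.
    by rewrite distnC.
  + exact: inj_comp F_inj (can_inj Kg).
  + move=> m; rewrite size -F_img; split=> [[x <-]|[x <-]].
      by exists (g x).
    by exists (matching_item x); rewrite /= gK.
Qed.

End Matching.

Arguments even_triples {n} F.

Lemma even_triplesS (n : nat) (F : 'I_n * option 'I_2 -> nat) :
  ~~ odd n -> even_triples F -> exists F', even_triples (n := n.+1) F'.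
Proof.
move=> n_even [FE F_even F_inj F_img].
pose shift m := m + 2 * odd m.
pose new (c : option 'I_2) :=
  if c is Some c then (if c == ord0 then 1 else 3 * n + 3) else 3 * n + 2.
pose F' (x : 'I_n.+1 * option 'I_2) :=
  if unlift ord_max x.1 is Some j then shift (F (j, x.2)) else new x.2.
have F'new c : F' (ord_max, c) = new c by rewrite /F' unlift_none.
have F'old j c : F' (lift ord_max j, c) = shift (F (j, c)).
  by rewrite /F' liftK.
have Fbnd x : 1 <= F x <= 3 * n by apply/F_img; exists x.
have shift_inj : injective shift by rewrite /shift => a b; lia.
have new_inj : injective new.
  move=> [[[|[|]] //= ?]|] [[[|[|]] //= ?]|] //=; rewrite /new /= => E;
    try lia; by congr Some; apply: val_inj.
(* Since [3 * n] is even, shifted odd labels lie between 3 and [3 * n + 1], while even ones stay at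
   most [3 * n]. *)
have new_old c x : new c <> shift (F x).
  by have := Fbnd x; rewrite /shift; case: c => [c|] /=; [case: ifP|]; lia.
exists F'; split.
- move=> i; case: (unliftP ord_max i) => [j|] ->; rewrite ?F'old ?F'new.
    have := F_even j; rewrite FE => even_dist.
    (* An even difference forces equal parity, so both ends move by the same amount. *)
    have odd_eq : odd (F (j, Some ord0)) = odd (F (j, Some ord_max)).
      move: even_dist; move: (F _) (F _) => b a.
      have [ba|ab] := leqP b a.
        by rewrite distnEl // oddB //; do 2!case: odd.
      by rewrite distnEr ?oddB ?(ltnW ab) //; do 2!case: odd.
    by rewrite /shift odd_eq distnDr (negPf even_dist) muln0 addn0.
  by rewrite /new /=; lia.
- move=> i; case: (unliftP ord_max i) => [j|] ->; rewrite ?F'old ?F'new.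
    by have := F_even j; rewrite /shift; lia.
  by rewrite /new; lia.
- move=> [i c] [j d].
  case: (unliftP ord_max i) => [i'|] ->; case: (unliftP ord_max j) => [j'|] ->;
    rewrite ?F'old ?F'new.
  + by move=> /shift_inj /F_inj [-> ->].
  + by move=> /esym /new_old.
  + by move=> /new_old.
  + by move=> /new_inj ->.
- move=> m; split=> [[[i c] <-]|m_bnd].
    case: (unliftP ord_max i) => [j|] ->; rewrite ?F'old ?F'new.
      by have := Fbnd (j, c); rewrite /shift; lia.
    by rewrite /new; case: c => [c|]; [case: ifP|]; lia.
  have [->|m1] := eqVneq m 1; first by exists (ord_max, Some ord0); rewrite F'new.
  have [->|m3] := eqVneq m (3 * n + 3).
    by exists (ord_max, Some ord_max); rewrite F'new.
  have [->|m2] := eqVneq m (3 * n + 2); first by exists (ord_max, None); rewrite F'new.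
  (* This inverts [shift]: with [m] different from 1 the truncated subtraction is exact, and an odd
     [m] is at most [3 * n + 1]. *)
  have /F_img [[j c] Fj] : 1 <= m - 2 * odd m <= 3 * n by lia.
  by exists (lift ord_max j, c); rewrite F'old Fj /shift; lia.
Qed.

Theorem theorem3p2 (t : nat) (ht : 1 <= t) :
  (exists f : copies (4 * t) (complete 2) + edge (copies (4 * t) (complete 2)) -> nat,
     super_graceful 1 f /\ even_edge_labels f) ->
  (exists f : copies (4 * t + 1) (complete 2) + edge (copies (4 * t + 1) (complete 2)) -> nat,
     super_graceful 1 f /\ even_edge_labels f).
Proof.
move=> /super_graceful_even_triplesP [F FP].
rewrite addn1; apply/super_graceful_even_triplesP.
by apply: even_triplesS FP; rewrite oddM.
Qed.
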